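(* Let $f:\mathbb{R}^D\to\mathbb{R}$ be a twice differentiable function whose Hessian $\bm{H}(\cdot)$ is Lipschitz continuous with constant $\gamma_H$, i.e. $\|\bm{H}(\bm{x}_1)-\bm{H}(\bm{x}_2)\|\le \gamma_H\|\bm{x}_1-\bm{x}_2\|$ for all $\bm{x}_1,\bm{x}_2\in\mathbb{R}^D$. Let $\bm{X}^{\langle n\rangle}=\{(\bm{x}^{(l)},z^{(l)}),\ l=1,\ldots,n\}$ be a data set of $n$ samples with distinct points $\bm{x}^{(l)}\in\mathbb{R}^D$ and $z^{(l)}=f(\bm{x}^{(l)})$, fix a sampled point $\bm{x}^{(i)}$ of $\bm{X}^{\langle n\rangle}$, and let $\bm{\Xi}^{\langle n\rangle}(\bm{x}^{(i)})=\bm{X}^{\langle n\rangle}\setminus\bm{x}^{(i)}$ be the set of the remaining samples. Then the gradient $\bm{g}^{(i)}$ of $f$ at $\bm{x}^{(i)}$ belongs to the set $$\mathcal{G}^{(i)}=\left\{\bm{g}\in\mathbb{R}^D:\ \begin{bmatrix}-\bm{u}_{ij}^\top\\ \bm{u}_{ij}^\top\end{bmatrix}\bm{g}\le\begin{bmatrix}-\tilde g_{ij}\\ \tilde g_{ij}\end{bmatrix}+\frac12\begin{bmatrix}\mu_{ij}\\ \mu_{ij}\end{bmatrix}H^{(i)}+\frac16\begin{bmatrix}\mu_{ij}^2\\ \mu_{ij}^2\end{bmatrix}\gamma_H,\ \ \forall\,\bm{x}^{(j)}\in\bm{\Xi}^{\langle n\rangle}(\bm{x}^{(i)})\right\},$$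 where vector inequalities are understood componentwise.
   Context: $\|\cdot\|$ denotes the Euclidean 2-norm for vectors and the spectral norm for matrices. $\bm{H}^{(i)}=\bm{H}(\bm{x}^{(i)})\in\mathbb{R}^{D\times D}$ is the Hessian of $f$ at $\bm{x}^{(i)}$, and the scalar $H^{(i)}=\|\bm{H}^{(i)}\|>0$ is its spectral norm. A sample $(\bm{x}^{(j)},z^{(j)})$ is referred to simply by its point $\bm{x}^{(j)}$. For two samples, $\bm{a}_{ij}=\bm{x}^{(j)}-\bm{x}^{(i)}$, $\mu_{ij}=\|\bm{a}_{ij}\|$, $\bm{u}_{ij}=\bm{a}_{ij}/\mu_{ij}$, and the directional slope estimate is $\tilde g_{ij}=\frac{z^{(j)}-z^{(i)}}{\mu_{ij}}$. *)

(* Defs.v *)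
From HB Require Import structures.
From mathcomp Require Import all_boot all_order all_algebra.
From mathcomp Require Import all_classical all_reals all_analysis.

Set Implicit Arguments.
Unset Strict Implicit.
Unset Printing Implicit Defensive.

Import Order.TTheory GRing.Theory Num.Theory.
Import numFieldNormedType.Exports.

Local Open Scope classical_set_scope.
Local Open Scope ring_scope.

(* The library norm on matrices is the sup norm. It induces the usual topology
   of R^D, so it is only used through differentiability; all the quantitative
   bounds use the following two norms. *)

Definition euclidean_norm (R : realType) (m : nat) (v : 'cV[R]_m) : R :=
  Num.sqrt (\sum_(k < m) v k 0 ^+ 2).

(* Operator norm induced by the Euclidean norm; the set is nonempty (v = 0) and
   bounded above, so that the supremum is a genuine one. *)
Definition spectral_norm (R : realType) (m n : nat) (A : 'M[R]_(m, n)) : R :=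
  sup [set euclidean_norm (A *m v) | v in [set v | euclidean_norm v <= 1]].

Definition gradient (R : realType) (D : nat) (f : 'cV[R]_D -> R)
    (x : 'cV[R]_D) : 'cV[R]_D :=
  \col_(k < D) 'D_(delta_mx k 0) f x.

(* Row k, column l: the l-th partial derivative of the k-th component of the
   gradient. *)
Definition hessian (R : realType) (D : nat) (f : 'cV[R]_D -> R)
    (x : 'cV[R]_D) : 'M[R]_D :=
  \matrix_(k < D, l < D)
    'D_(delta_mx l 0) (fun y => 'D_(delta_mx k 0) f y) x.

(* Frechet differentiability of f and of its gradient. *)
Definition twice_differentiable (R : realType) (D : nat)
    (f : 'cV[R]_D -> R) : Prop :=
  (forall x, differentiable f x) /\ (forall x, differentiable (gradient f) x).

Definition hessian_lipschitz (R : realType) (D : nat)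
    (f : 'cV[R]_D -> R) (gammaH : R) : Prop :=
  forall x1 x2 : 'cV[R]_D,
    spectral_norm (hessian f x1 - hessian f x2)
      <= gammaH * euclidean_norm (x1 - x2).

Definition sample (R : realType) (D : nat) : Type := ('cV[R]_D * R)%type.

Definition dataset (R : realType) (D n : nat)
    (x : 'I_n -> 'cV[R]_D) (z : 'I_n -> R) : set (sample R D) :=
  [set (x l, z l) | l in [set: 'I_n]].

Definition dist (R : realType) (D : nat) (si sj : sample R D) : R :=
  euclidean_norm (sj.1 - si.1).

Definition direction (R : realType) (D : nat) (si sj : sample R D) : 'cV[R]_D :=
  (dist si sj)^-1 *: (sj.1 - si.1).

Definition slope (R : realType) (D : nat) (si sj : sample R D) : R :=
  (sj.2 - si.2) / dist si sj.

Definition le_componentwise (R : realType) (m : nat) (a b : 'cV[R]_m) : Prop :=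
  forall k : 'I_m, a k 0 <= b k 0.

Definition stack2 (R : realType) (a b : R) : 'cV[R]_(1 + 1) :=
  col_mx a%:M b%:M.

(* Xi is the set of the samples other than si, and Hi stands for the spectral
   norm of the Hessian at si.1. *)
Definition gradient_set (R : realType) (D : nat) (Xi : set (sample R D))
    (si : sample R D) (Hi gammaH : R) : set 'cV[R]_D :=
  [set g | forall sj, Xi sj ->
     let u := direction si sj in
     let mu := dist si sj in
     le_componentwise
       (col_mx (- u^T) u^T *m g)
       (stack2 (- slope si sj) (slope si sj)
        + (1 / 2 * Hi) *: stack2 mu mu
        + (1 / 6 * gammaH) *: stack2 (mu ^+ 2) (mu ^+ 2))].

(* Main.v *)
Require Import Defs.
From HB Require Import structures.
From mathcomp Require Import all_boot all_order all_algebra.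
From mathcomp Require Import all_classical all_reals all_analysis.
From mathcomp Require Import ring lra.

Set Implicit Arguments.
Unset Strict Implicit.
Unset Printing Implicit Defensive.

Import Order.TTheory GRing.Theory Num.Theory.
Import numFieldNormedType.Exports.

Local Open Scope classical_set_scope.
Local Open Scope ring_scope.

(** Write x, y for the two points x^(i), x^(j), put a = y - x and mu = |a|, and
    restrict f to the segment: h(t) = f (x + t a). Then h'(0) is the product of
    the gradient at x with a, and h''(t) = a^T H(x + t a) a. Cauchy-Schwarz and
    the definition of the spectral norm give |h''(0)| <= |H(x)| mu^2, and the
    Lipschitz hypothesis on the Hessian gives
    |h''(t) - h''(0)| <= gammaH mu^3 t, so that
      |h''(t)| <= K + L t   with K = |H(x)| mu^2 and L = gammaH mu^3.
    Integrating this twice yields |h(1) - h(0) - h'(0)| <= K / 2 + L / 6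
    ([taylor2_error]); in terms of f this is [gradient_remainder], and dividing
    by mu gives a bound on the distance between the slope estimate and the
    product of the gradient with the direction u. The two rows of the system
    that defines the set are the two sides of this absolute value.

    The double integration is carried out by two uses of the mean value theorem,
    which asks only that the derivatives exist: it is applied to h minus the cubic
    polynomial whose second derivative is the bound K + L t. *)

(** * Euclidean and spectral norms *)

(** The argument is that B u - C v has a nonnegative squared norm, where
    B = |v|^2 and C = u . v; that squared norm is B (|u|^2 B - C^2). *)
Lemma cauchy_schwarz (R : realType) (m : nat) (u v : 'cV[R]_m) :
  `|\sum_k u k 0 * v k 0| <= euclidean_norm u * euclidean_norm v.
Proof.
rewrite /euclidean_norm.
set A := \sum_k u k 0 ^+ 2; set B := \sum_k v k 0 ^+ 2.
set C := \sum_k _.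
have A0 : 0 <= A by apply: sumr_ge0 => k _; rewrite sqr_ge0.
have B0 : 0 <= B by apply: sumr_ge0 => k _; rewrite sqr_ge0.
rewrite -sqrtrM// -sqrtr_sqr ler_wsqrtr//.
have : 0 <= \sum_k (B * u k 0 - C * v k 0) ^+ 2.
  by apply: sumr_ge0 => k _; rewrite sqr_ge0.
have -> : \sum_k (B * u k 0 - C * v k 0) ^+ 2 = B * (A * B - C ^+ 2).
  transitivity (B ^+ 2 * A - 2 * B * C * C + C ^+ 2 * B); last by ring.
  rewrite (eq_bigr (fun k => B ^+ 2 * u k 0 ^+ 2 - 2 * B * C * (u k 0 * v k 0)
    + C ^+ 2 * v k 0 ^+ 2)); last by move=> k _; ring.
  by rewrite big_split/= sumrB -!mulr_sumr.
(* If B = 0 the inequality above is void, but then v = 0. *)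
move: B0; rewrite le_eqVlt => /predU1P[B0 _|B0]; last by rewrite pmulr_rge0 ?subr_ge0.
have v0 k : v k 0 = 0.
  apply/eqP; rewrite -sqrf_eq0; apply/eqP.
  have /psumr_eq0P : \sum_k v k 0 ^+ 2 = 0 by rewrite -/B -B0.
  by apply=> // j _; rewrite sqr_ge0.
rewrite /C big1 ?expr0n/= ?mulr_ge0// -?B0//.
by move=> k _; rewrite v0 mulr0.
Qed.

Lemma euclidean_norm_ge0 (R : realType) (m : nat) (v : 'cV[R]_m) :
  0 <= euclidean_norm v.
Proof. exact: sqrtr_ge0. Qed.

Lemma euclidean_normZ (R : realType) (m : nat) (c : R) (v : 'cV[R]_m) :
  euclidean_norm (c *: v) = `|c| * euclidean_norm v.
Proof.
rewrite /euclidean_norm -sqrtr_sqr -sqrtrM ?sqr_ge0// mulr_sumr.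
by congr Num.sqrt; apply: eq_bigr => k _; rewrite mxE exprMn.
Qed.

Lemma euclidean_norm_eq0 (R : realType) (m : nat) (v : 'cV[R]_m) :
  euclidean_norm v = 0 -> v = 0.
Proof.
move=> /eqP; rewrite sqrtr_eq0 => s0; apply/colP => k; rewrite mxE.
apply/eqP; rewrite -sqrf_eq0; apply/eqP.
have /psumr_eq0P : \sum_k v k 0 ^+ 2 = 0.
  by apply/eqP; rewrite eq_le s0 sumr_ge0// => j _; rewrite sqr_ge0.
by apply=> // j _; rewrite sqr_ge0.
Qed.

(** The spectral norm is a supremum, which bounds the elements of its set only if
    that set has an upper bound; the Frobenius norm of A is one, by
    Cauchy-Schwarz on each row. *)
Lemma mulmx_norm_bounded (R : realType) (m n : nat) (A : 'M[R]_(m, n)) :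
  exists K, forall v, euclidean_norm v <= 1 -> euclidean_norm (A *m v) <= K.
Proof.
exists (Num.sqrt (\sum_i euclidean_norm (row i A)^T ^+ 2)) => v v1.
rewrite ler_wsqrtr//; apply: ler_sum => i _.
rewrite mxE -real_normK ?num_real// ler_pXn2r ?nnegrE ?euclidean_norm_ge0//.
have -> : \sum_j A i j * v j 0 = \sum_j (row i A)^T j 0 * v j 0.
  by apply: eq_bigr => j _; rewrite !mxE.
apply: (le_trans (cauchy_schwarz _ _)).
by rewrite ler_piMr ?euclidean_norm_ge0.
Qed.

(** Rescaling v to the unit sphere turns this into an instance of the supremum. *)
Lemma spectral_norm_mulmx (R : realType) (m n : nat) (A : 'M[R]_(m, n))
    (v : 'cV[R]_n) :
  euclidean_norm (A *m v) <= spectral_norm A * euclidean_norm v.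
Proof.
have [v0|v0] := eqVneq (euclidean_norm v) 0.
  have -> := euclidean_norm_eq0 v0.
  by rewrite mulmx0 -(scale0r (0 : 'cV_m)) -(scale0r (0 : 'cV_n))
    !euclidean_normZ !normr0 !mul0r mulr0.
have nv : 0 < euclidean_norm v by rewrite lt0r v0 euclidean_norm_ge0.
rewrite -ler_pdivrMr// mulrC -[X in X * _](ger0_norm (ltW _)) ?invr_gt0//.
rewrite -euclidean_normZ scalemxAr; apply: ub_le_sup.
  have [K HK] := mulmx_norm_bounded A.
  by exists K => _ [w w1 <-]; exact: HK.
exists ((euclidean_norm v)^-1 *: v) => //=.
by rewrite euclidean_normZ ger0_norm ?invr_ge0 ?euclidean_norm_ge0// mulVf.
Qed.

Definition quadratic_form (R : realType) (D : nat) (M : 'M[R]_D)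
    (v : 'cV[R]_D) : R :=
  \sum_k v k 0 * (M *m v) k 0.

Lemma quadratic_form_le (R : realType) (D : nat) (M : 'M[R]_D) (v : 'cV[R]_D) :
  `|quadratic_form M v| <= spectral_norm M * euclidean_norm v ^+ 2.
Proof.
apply: (le_trans (cauchy_schwarz _ _)).
by rewrite expr2 mulrA [leRHS]mulrC ler_wpM2l ?euclidean_norm_ge0
  ?spectral_norm_mulmx.
Qed.

Lemma quadratic_formB (R : realType) (D : nat) (M N : 'M[R]_D) (v : 'cV[R]_D) :
  quadratic_form (M - N) v = quadratic_form M v - quadratic_form N v.
Proof.
by rewrite -sumrB; apply: eq_bigr => k _; rewrite mulmxBl !mxE mulrBr.
Qed.

(** * A second-order Taylor estimate in one variable *)

(** The functions p1 and p of the proof are h1 and h minus polynomials chosen so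
    that p1' = h2 - (K + L t) <= 0 and p' = p1 - p1(0). The mean value theorem on
    p1 then gives p' <= 0, and on p it gives p(1) <= p(0), which is the claim. *)
Lemma taylor2_upper_bound (R : realType) (h h1 h2 : R -> R) (K L : R) :
  (forall t : R, is_derive t 1 h (h1 t)) ->
  (forall t : R, is_derive t 1 h1 (h2 t)) ->
  (forall t, 0 <= t -> h2 t <= K + L * t) ->
  h 1 - h 0 - h1 0 <= K / 2 + L / 6.
Proof.
move=> dh dh1 h2le.
pose p1 t := h1 t - (K * t + L / 2 * t ^+ 2).
have dp1 (t : R) : is_derive t 1 p1 (h2 t - (K + L * t)).
  rewrite /p1; apply: is_derive_eq.
  by rewrite /GRing.scale/=; field.
pose p t := h t - (h1 0 * t + K / 2 * t ^+ 2 + L / 6 * t ^+ 3).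
have dp (t : R) : is_derive t 1 p (p1 t - p1 0).
  rewrite /p; apply: is_derive_eq.
  by rewrite /p1 /GRing.scale/=; field.
have cont (g g' : R -> R) a b :
    (forall t : R, is_derive t 1 g (g' t)) -> {within `[a, b], continuous g}.
  move=> dg; apply: derivable_within_continuous => t _.
  by have [] := dg t.
have p1le t : 0 <= t -> p1 t <= p1 0.
  move=> t0; have [c c0 e] := MVT_segment t0 (fun t _ => dp1 t) (cont _ _ _ _ dp1).
  have /andP[c1 c2] : 0 <= c <= t by move: c0; rewrite in_itv.
  rewrite -subr_le0 e subr0 mulr_le0_ge0// subr_le0; exact: h2le.
have [c c0 e] := MVT_segment ler01 (fun t _ => dp t) (cont _ _ _ _ dp).
have /andP[c1 c2] : 0 <= c <= 1 by move: c0; rewrite in_itv.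
have := p1le _ c1; rewrite -subr_le0.
rewrite -[X in X <= _]mulr1 -[X in _ * X <= _]subr0 -e /p.
by move=> H; lra.
Qed.

(** The lower bound is the upper bound applied to - h. *)
Lemma taylor2_error (R : realType) (h h1 h2 : R -> R) (K L : R) :
  (forall t : R, is_derive t 1 h (h1 t)) ->
  (forall t : R, is_derive t 1 h1 (h2 t)) ->
  (forall t, 0 <= t -> `|h2 t| <= K + L * t) ->
  `|h 1 - h 0 - h1 0| <= K / 2 + L / 6.
Proof.
move=> dh dh1 h2le; rewrite ler_norml; apply/andP; split; last first.
  apply: (taylor2_upper_bound dh dh1) => t t0.
  exact: le_trans (ler_norm _) (h2le _ t0).
have := @taylor2_upper_bound R (- h) (- h1) (- h2) K L
  (fun t => is_deriveN (dh t)) (fun t => is_deriveN (dh1 t)).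
rewrite !fctE => H; suff : - h 1 - - h 0 - - h1 0 <= K / 2 + L / 6 by lra.
apply: H => t t0; apply: le_trans (h2le _ t0).
by rewrite -normrN ler_norm.
Qed.

(** * Derivatives along a line *)

(** This is where Frechet differentiability matters: the directional derivative
    is linear in the direction, hence determined by the partial derivatives. *)
Lemma derive_gradient (R : realType) (D : nat) (f : 'cV[R]_D -> R)
    (x a : 'cV[R]_D) :
  differentiable f x -> 'D_a f x = \sum_k a k 0 * gradient f x k 0.
Proof.
move=> df; rewrite deriveE//.
have {1}-> : a = \sum_k a k 0 *: delta_mx k 0.
  rewrite {1}(matrix_sum_delta a); apply: eq_bigr => k _.
  by rewrite big_ord1.
rewrite linear_sum; apply: eq_bigr => k _.
by rewrite linearZ mxE deriveE.
Qed.

Lemma is_derive_line (R : realType) (D : nat) (f : 'cV[R]_D -> R)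
    (x a : 'cV[R]_D) (t : R) :
  differentiable f (x + t *: a) ->
  is_derive t 1 (fun s => f (x + s *: a)) ('D_a f (x + t *: a)).
Proof.
move=> df.
have dl : is_diff t (fun s : R => x + s *: a) (fun s : R => s *: a).
  have := is_diffD (is_diff_cst x t) (is_diff_scalel t a).
  by rewrite add0r.
have dc : is_diff t (f \o (fun s : R => x + s *: a))
    ('d f (x + t *: a) \o (fun s : R => s *: a)).
  exact: is_diff_comp.
apply: DeriveDef.
  by apply: diff_derivable.
by rewrite deriveE// ?diff_val/= ?scale1r ?deriveE//.
Qed.

Lemma differentiable_gradient_coord (R : realType) (D : nat) (f : 'cV[R]_D -> R)
    (k : 'I_D) (y : 'cV[R]_D) :
  differentiable (gradient f) y ->
  differentiable (fun w => gradient f w k 0) y.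
Proof.
move=> df; apply: (differentiable_comp (g := fun N : 'cV[R]_D => N k 0)) => //.
exact: differentiable_coord.
Qed.

(** Each component of the gradient is itself a differentiable function, whose
    gradient is a row of the Hessian; so the first derivative along the line can
    be differentiated term by term. *)
Lemma is_derive_gradient_line (R : realType) (D : nat) (f : 'cV[R]_D -> R)
    (x a : 'cV[R]_D) (t : R) :
  differentiable (gradient f) (x + t *: a) ->
  is_derive t 1 (fun s => \sum_k a k 0 * gradient f (x + s *: a) k 0)
     (quadratic_form (hessian f (x + t *: a)) a).
Proof.
move=> dg.
have dk k : is_derive t 1 (fun s => a k 0 * gradient f (x + s *: a) k 0)
    (a k 0 * (hessian f (x + t *: a) *m a) k 0).
  have dgk := differentiable_gradient_coord k dg.
  have := is_deriveZ (a k 0) (is_derive_line dgk).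
  rewrite derive_gradient// mxE.
  rewrite (eq_bigr (fun j => hessian f (x + t *: a) k j * a j 0))//.
  move=> j _; rewrite !mxE mulrC; congr (_ * _).
  by congr (derive _ _ _); apply/funext => w; rewrite mxE.
have := is_derive_sum dk.
by rewrite fct_sumE.
Qed.

(** * The gradient estimate *)

(** Along the segment the second derivative at time t is compared with its value
    at time 0, which [quadratic_form_le] bounds by the spectral norm of the
    Hessian at x. Their difference is the quadratic form of the difference of two
    Hessians at distance t |y - x|. *)
Lemma gradient_remainder (R : realType) (D : nat) (f : 'cV[R]_D -> R)
    (gammaH : R) (x y : 'cV[R]_D) :
  twice_differentiable f -> hessian_lipschitz f gammaH ->
  `|f y - f x - \sum_k (y - x) k 0 * gradient f x k 0| <=
    spectral_norm (hessian f x) * euclidean_norm (y - x) ^+ 2 / 2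
    + gammaH * euclidean_norm (y - x) ^+ 3 / 6.
Proof.
move=> [df dg] lip; set a := y - x; set mu := euclidean_norm a.
have dh (t : R) : is_derive t 1 (fun s => f (x + s *: a))
    (\sum_k a k 0 * gradient f (x + t *: a) k 0).
  by rewrite -derive_gradient//; exact: is_derive_line.
have dh1 (t : R) := is_derive_gradient_line (dg (x + t *: a)).
have := taylor2_error dh dh1.
rewrite scale1r scale0r addr0 [x + a]addrC subrK; apply=> t t0.
rewrite -[quadratic_form _ _](subrK (quadratic_form (hessian f x) a)).
rewrite -quadratic_formB (le_trans (ler_normD _ _))// addrC lerD//.
  exact: quadratic_form_le.
apply: (le_trans (quadratic_form_le _ _)).
apply: (le_trans (ler_wpM2r (exprn_ge0 _ (euclidean_norm_ge0 a)) (lip _ _))).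
rewrite [x + _]addrC addrK euclidean_normZ ger0_norm// le_eqVlt.
by apply/orP; left; apply/eqP; rewrite -/mu; ring.
Qed.

Theorem theorem3p1 (R : realType) (D : nat) (f : 'cV[R]_D -> R) (gammaH : R)
    (n : nat) (x : 'I_n -> 'cV[R]_D) (z : 'I_n -> R) (i : 'I_n)
    (f_diff2 : twice_differentiable f)
    (hess_lip : hessian_lipschitz f gammaH)
    (x_distinct : injective x)
    (z_values : forall l : 'I_n, z l = f (x l)) :
  gradient_set (dataset x z `\ (x i, z i)) (x i, z i)
    (spectral_norm (hessian f (x i))) gammaH (gradient f (x i)).
Proof.
move=> _ [[j _ <-] ji] /=.
have xij : x j - x i != 0.
  rewrite subr_eq0; apply/negP => /eqP/x_distinct e.
  by apply: ji; rewrite e.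
have := gradient_remainder (x i) (x j) f_diff2 hess_lip.
rewrite /direction /slope /dist /= !z_values.
set mu := euclidean_norm _ => rem.
have mu0 : 0 < mu.
  rewrite lt0r euclidean_norm_ge0 andbT.
  by apply: contra_neq xij; exact: euclidean_norm_eq0.
set S := (\sum_k _) in rem.
have uS : (mu^-1 *: (x j - x i))^T *m gradient f (x i) = (S / mu)%:M.
  apply/matrixP => p q; rewrite !ord1 !mxE mulr1n /S mulr_suml.
  by apply: eq_bigr => k _; rewrite !mxE; ring.
rewrite mul_col_mx mulNmx uS /stack2 !scale_col_mx !add_col_mx.
set H := spectral_norm _ in rem *.
have remd : `|(f (x j) - f (x i)) / mu - S / mu| <=
    1 / 2 * H * mu + 1 / 6 * gammaH * mu ^+ 2.
  rewrite -mulrBl normrM [`|mu^-1|]gtr0_norm ?invr_gt0// ler_pdivrMr//.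
  by apply: (le_trans rem); rewrite le_eqVlt; apply/orP; left; apply/eqP; field.
move: remd; rewrite ler_norml => /andP[lo up] k.
rewrite -[k]splitK; case: (fintype.split k) => l; rewrite /= ord1.
  rewrite !col_mxEu !mxE !mulr1n.
  move: up; lra.
rewrite !col_mxEd !mxE !mulr1n.
move: lo; lra.
Qed.
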